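(* Consider a matching market consisting of a finite simple bipartite graph $G=(V,E)$ with $V = D \sqcup H$ (doctors and hospitals), a matroid $\mathbf{M}_h=(E(h),\mathcal{I}_h)$ for each $h\in H$ in which every singleton $\{e\}$, $e\in E(h)$, is independent, preferences $\succsim_d$ for each $d\in D$, and responsive preferences $\succsim_h$ for each $h\in H$, all as specified in the context. Let $\mathcal{SSS}$ be the set of super-stable matchings in $G$ (matchings $\mu$ such that no edge in $E\setminus\mu$ super weakly blocks $\mu$), and let $\mathcal{C}_{SS}$ be the super core (the set of matchings $\mu$ in $G$ such that no non-empty subset of $V$ super weakly blocks $\mu$). Then $\mathcal{SSS}=\mathcal{C}_{SS}$.
   Context: Notation: for a set $X$ and an element $x$, $X+x := X\cup\{x\}$ and $X-x := X\setminus\{x\}$. Graph: $G=(V,E)$ is a finite simple undirected bipartite graph; $V$ is partitioned into $D$ (doctors) and $H$ (hospitals), and every edge joins a vertex of $D$ and a vertex of $H$. The edge joining $d\in D$ and $h\in H$, if it exists, is written $(d,h)$. For $F\subseteq E$ and $v\in V$, $F(v)$ is the set of edges of $F$ incident to $v$. Matroids: for each $h\in H$, $\mathbf{M}_h=(E(h),\mathcal{I}_h)$ is a matroid (with family of independent sets $\mathcal{I}_h$) such that $\{e\}\in\mathcal{I}_h$ for every $e\in E(h)$. If $I\in\mathcal{I}_h$, $e\in E(h)\setminus I$ and $I+e\notin\mathcal{I}_h$, then $\mathsf{C}_{\mathbf{M}_h}(e,I)$ denotes the fundamental circuit, i.e. the unique circuit of $\mathbf{M}_h$ contained in $I+e$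 (it contains $e$), and $\mathsf{D}_{\mathbf{M}_h}(e,I):=\mathsf{C}_{\mathbf{M}_h}(e,I)-e$. Preferences: for each $d\in D$, $\succsim_d$ is a transitive and complete binary relation on $E(d)\cup\{\emptyset\}$ (complete: for all elements $e,f$, including $e=f$, at least one of $e\succsim_d f$, $f\succsim_d e$ holds) such that for every $e\in E(d)$, $e\succsim_d\emptyset$ and $\emptyset\not\succsim_d e$. For each $h\in H$, $\succsim_h$ is a transitive and complete binary relation on $\mathcal{I}_h$ such that for every non-empty $I\in\mathcal{I}_h$, $I\succsim_h\emptyset$ and $\emptyset\not\succsim_h I$. For $v\in V$, $a\succ_v b$ means $a\succsim_v b$ and $b\not\succsim_v a$; $a\sim_v b$ means $a\succsim_v b$ and $b\succsim_v a$. For $e,f\in E(h)$, write $e\succsim_h f$, $e\succ_h f$, $e\sim_h f$ for $\{e\}\succsim_h\{f\}$, $\{e\}\succ_h\{f\}$, $\{e\}\sim_h\{f\}$. Responsiveness: for every $h\in H$: (1) for every $I\in\mathcal{I}_h$ and $e\in I$, $I\succ_h I-e$; (2) for every $I\in\mathcal{I}_h$, $e\in E(h)\setminus I$ and $f\in I$ with $I+e-f\in\mathcal{I}_h$, we have $I+e-f\succsim_h I$ if and only if $e\succsim_h f$. Matchings: a matching in $G$ is a subset $\mu\subseteq E$ with $|\mu(d)|\le 1$ for every $d\in D$ and $\mu(h)\in\mathcal{I}_h$ for every $h\in H$. For a doctor $d$, $\mu(d)$ is identified with its unique element if non-empty (and is $\emptyset$ otherwise). Blocking edges: let $\mu$ be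 a matching and $e=(d,h)\in E\setminus\mu$. The edge $e$ weakly blocks $\mu$ on $d$ if $e\succsim_d\mu(d)$. It weakly blocks $\mu$ on $h$ if either $\mu(h)+e\in\mathcal{I}_h$, or $\mu(h)+e\notin\mathcal{I}_h$ and there is $f\in\mathsf{D}_{\mathbf{M}_h}(e,\mu(h))$ with $e\succsim_h f$. The edge $e$ super weakly blocks $\mu$ if it weakly blocks $\mu$ on both $d$ and $h$. Blocking coalitions: for non-empty $C\subseteq V$, $E(C)$ is the set of edges $(d,h)\in E$ with $d,h\in C$, and $\mathcal{M}(C)$ is the set of matchings $\sigma$ in $G$ with $\sigma(v)\subseteq E(C)$ for every $v\in C$. A non-empty set $C\subseteq V$ super weakly blocks a matching $\mu$ if there is $\sigma\in\mathcal{M}(C)$ such that $\sigma(v)\succsim_v\mu(v)$ for every $v\in C$, and $\sigma(v)\neq\mu(v)$ for some $v\in C$. *)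

(* Defs.v *)
(* MathComp. *)
From mathcomp Require Import all_boot.

Set Implicit Arguments.
Unset Strict Implicit.
Unset Printing Implicit Defensive.

Record matroid (T : finType) := Matroid {
  ground : {set T};
  indep : {set {set T}};
  indep_ground : forall I : {set T}, I \in indep -> I \subset ground;
  indep0 : set0 \in indep;
  indepS : forall I J : {set T}, J \in indep -> I \subset J -> I \in indep;
  indep_aug : forall I J : {set T}, I \in indep -> J \in indep -> #|I| < #|J| ->
    exists2 e, e \in J :\: I & e |: I \in indep
}.

Section MatroidCircuits.
Variables (T : finType) (M : matroid T).

Definition circuit (C : {set T}) : bool :=
  minset [pred X : {set T} | (X \subset ground M) && (X \notin indep M)] C.

(* Meaningful when I is independent, e is in ground M :\: I and e |: I is
   dependent: there is then exactly one circuit to pick. *)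
Definition fund_circuit (e : T) (I : {set T}) : {set T} :=
  odflt set0 [pick C : {set T} | circuit C & C \subset e |: I].

Definition fund_dep (e : T) (I : {set T}) : {set T} := fund_circuit e I :\ e.

End MatroidCircuits.

Definition strict (T : Type) (R : rel T) : rel T :=
  fun a b => R a b && ~~ R b a.

Definition complete_transitive_on (T : finType) (A : {set T}) (R : rel T) :=
  {in A &, total R} /\ {in A & &, transitive R}.

(* The vertex set is D + H, and (d, h) : D * H stands for the edge joining d
   and h. *)
Definition incident (D H : finType) (v : D + H) (e : D * H) : bool :=
  match v with inl d => e.1 == d | inr h => e.2 == h end.

Definition edges_at (D H : finType) (F : {set D * H}) (v : D + H) :
  {set D * H} := [set e in F | incident v e].

(* A doctor compares elements of option (D * H), where None is the empty
   assignment.  Preference relations are only constrained (and only used) on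
   the domains E(d) + None for doctors and the independent sets for hospitals. *)
Record market (D H : finType) := Market {
  edges : {set D * H};
  mat : H -> matroid (D * H)%type;
  dpref : D -> rel (option (D * H));
  hpref : H -> rel {set D * H};
  ground_mat : forall h, ground (mat h) = edges_at edges (inr h);
  indep1 : forall h e, e \in edges_at edges (inr h) ->
    [set e] \in indep (mat h);
  dpref_order : forall d,
    complete_transitive_on (None |: Some @: edges_at edges (inl d)) (dpref d);
  dpref_None : forall d e, e \in edges_at edges (inl d) ->
    strict (dpref d) (Some e) None;
  hpref_order : forall h, complete_transitive_on (indep (mat h)) (hpref h);
  hpref_set0 : forall h I, I \in indep (mat h) -> I != set0 ->
    strict (hpref h) I set0
}.

Section Market.
Variables (D H : finType) (G : market D H).

Local Notation edge := (D * H)%type.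
Local Notation vertex := (D + H)%type.
Local Notation E := (edges G).

Definition responsive : Prop :=
  forall h,
    (forall (I : {set edge}) e, I \in indep (mat G h) -> e \in I ->
       strict (hpref G h) I (I :\ e)) /\
    (forall (I : {set edge}) e f, I \in indep (mat G h) ->
       e \in edges_at E (inr h) :\: I -> f \in I ->
       (e |: I) :\ f \in indep (mat G h) ->
       hpref G h ((e |: I) :\ f) I <-> hpref G h [set e] [set f]).

Definition matching (mu : {set edge}) : bool :=
  [&& mu \subset E,
      [forall d : D, #|edges_at mu (inl d)| <= 1] &
      [forall h : H, edges_at mu (inr h) \in indep (mat G h)]].

Definition doctor_edge (mu : {set edge}) (d : D) : option edge :=
  [pick e in edges_at mu (inl d)].

Definition weakly_blocks_on_doctor (e : edge) (mu : {set edge}) : bool :=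
  dpref G e.1 (Some e) (doctor_edge mu e.1).

Definition weakly_blocks_on_hospital (e : edge) (mu : {set edge}) : bool :=
  let h := e.2 in
  let muh := edges_at mu (inr h) in
  (e |: muh \in indep (mat G h)) ||
  (e |: muh \notin indep (mat G h)) &&
    [exists f in fund_dep (mat G h) e muh, hpref G h [set e] [set f]].

Definition edge_super_weakly_blocks (e : edge) (mu : {set edge}) : bool :=
  weakly_blocks_on_doctor e mu && weakly_blocks_on_hospital e mu.

Definition super_stable_matchings : {set {set edge}} :=
  [set mu | matching mu &
            [forall e in E :\: mu, ~~ edge_super_weakly_blocks e mu]].

Definition induced_edges (C : {set vertex}) : {set edge} :=
  [set e in E | (inl e.1 \in C) && (inr e.2 \in C)].

Definition coalition_matchings (C : {set vertex}) : {set {set edge}} :=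
  [set sigma | matching sigma &
               [forall v in C, edges_at sigma v \subset induced_edges C]].

Definition weakly_prefers (v : vertex) (sigma mu : {set edge}) : bool :=
  match v with
  | inl d => dpref G d (doctor_edge sigma d) (doctor_edge mu d)
  | inr h => hpref G h (edges_at sigma (inr h)) (edges_at mu (inr h))
  end.

Definition coalition_super_weakly_blocks
    (C : {set vertex}) (mu : {set edge}) : bool :=
  [exists sigma in coalition_matchings C,
     [forall v in C, weakly_prefers v sigma mu] &&
     [exists v in C, edges_at sigma v != edges_at mu v]].

Definition super_core : {set {set edge}} :=
  [set mu | matching mu &
            [forall C : {set vertex},
               (C != set0) ==> ~~ coalition_super_weakly_blocks C mu]].

End Market.

(* Main.v *)
Require Import Defs.
From mathcomp Require Import all_boot.

Set Implicit Arguments.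
Unset Strict Implicit.
Unset Printing Implicit Defensive.

(** A super weakly blocking edge e = (d, h) gives a blocking coalition formed by
    h and the doctors assigned to it after e is inserted into mu(h), possibly in
    exchange for an element of the fundamental circuit of e.  Conversely, a
    blocking sigma has a hospital h of the coalition with an edge in
    sigma(h) \ mu(h).  If none of these edges blocked mu on h, then each
    e in sigma(h) \ mu(h) could be exchanged for a strictly better f in its
    fundamental circuit with respect to mu(h); performing these exchanges one at
    a time and then adding the missing edges of mu(h) shows that h strictly
    prefers mu(h) to sigma(h). *)

(** * Exchange properties of independent sets and fundamental circuits *)

Section MatroidExchange.
Variables (T : finType) (M : matroid T).
Implicit Types (A B I J K C : {set T}) (e f : T).

Lemma indep_extend A B : A \in indep M -> B \in indep M ->
  exists K, [/\ K \in indep M, A \subset K, K \subset A :|: B & #|B| <= #|K|].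
Proof.
move=> Ai Bi.
(* Induction on a bound for the truncated difference [#|B| - #|A|]: each augmentation from [B]
   lowers it by one. *)
have [n le_n] : exists n, #|B| - #|A| <= n by exists (#|B| - #|A|).
elim: n A Ai le_n => [|n IHn] A Ai le_n.
  by exists A; split; rewrite ?subsetUl // -subn_eq0 -leqn0.
have [leBA|ltAB] := leqP #|B| #|A|; first by exists A; split; rewrite ?subsetUl.
have [x /setDP[xB xA] xAi] := indep_aug Ai Bi ltAB.
have [|K [Ki sAK sKU leK]] := IHn _ xAi.
  by rewrite cardsU1 xA add1n subnS; case: (_ - _) le_n.
exists K; split=> //; first exact: subset_trans (subsetU1 _ _) sAK.
apply: subset_trans sKU _; apply/subsetP=> y; rewrite !inE.
by case/orP=> [/orP[/eqP->|->]|->]; rewrite ?xB ?orbT.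
Qed.

Lemma circuit_dep C K : circuit M C -> C \subset K -> K \notin indep M.
Proof.
case/minsetP=> /andP[_ Cd] _ sCK.
by apply: contra Cd => Ki; apply: indepS Ki sCK.
Qed.

Lemma circuit_indepD1 C f : circuit M C -> f \in C -> C :\ f \in indep M.
Proof.
case/minsetP=> /andP[sCg _] minC fC; apply/negPn/negP=> dep.
have: C :\ f = C.
  by apply: minC (subsetDl _ _); rewrite inE dep (subset_trans (subsetDl _ _) sCg).
by move/setP/(_ f); rewrite !inE eqxx fC.
Qed.

(** A dependent subset of the ground set contains a minimal one, so the [pick] succeeds and the
    default [set0] does not arise. *)
Lemma fund_circuitP e I : I \in indep M -> e \in ground M ->
  e |: I \notin indep M ->
  circuit M (fund_circuit M e I) /\ fund_circuit M e I \subset e |: I.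
Proof.
move=> Ii eg dep; rewrite /fund_circuit; case: pickP => [C /andP[] //|none].
have [|C Cm sC] := @minset_exists _
  [pred X : {set T} | (X \subset ground M) && (X \notin indep M)] (e |: I).
  by rewrite inE dep andbT subUset sub1set eg (indep_ground Ii).
by have := none C; rewrite /circuit Cm sC.
Qed.

Lemma fund_dep_subset e I : I \in indep M -> e \in ground M ->
  e |: I \notin indep M -> fund_dep M e I \subset I.
Proof. by move=> Ii eg dep; have [_] := fund_circuitP Ii eg dep; rewrite subDset. Qed.

(** The circuit minus [f] is independent, so it extends inside [e |: I] to an independent [K] with
    at least [#|I|] elements. Since [K] cannot contain the whole circuit, it avoids [f], and
    cardinality forces it to be all of [(e |: I) :\ f]. *)
Lemma fund_dep_exchange e f I : I \in indep M -> e \in ground M ->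
  e |: I \notin indep M -> f \in fund_dep M e I -> (e |: I) :\ f \in indep M.
Proof.
move=> Ii eg dep fD; have [Cc sC] := fund_circuitP Ii eg dep.
have fI := subsetP (fund_dep_subset Ii eg dep) _ fD.
have fC : f \in fund_circuit M e I by move: fD => /setD1P[].
have [K [Ki sCK sKU leK]] := indep_extend (circuit_indepD1 Cc fC) Ii.
have fK : f \notin K.
  apply/negP=> fK; have := circuit_dep (K := K) Cc; rewrite Ki => /(_ _)/negP[] //.
  by rewrite -(setD1K fC) subUset sub1set fK.
have eI : e \notin I by apply: contra dep => eI; rewrite (setUidPr _) ?sub1set.
have sK : K \subset (e |: I) :\ f.
  rewrite subsetD1 fK andbT (subset_trans sKU) // subUset subsetUr andbT.
  exact: subset_trans (subsetDl _ _) sC.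
suff -> : (e |: I) :\ f = K by [].
apply/esym/eqP; rewrite eqEcard sK (leq_trans _ leK) //.
have := cardsD1 f (e |: I); rewrite cardsU1 eI !inE fI orbT.
by rewrite !add1n => -[->].
Qed.

(* The fundamental circuit is not spanned by J :\ e, as otherwise e would be. *)
Lemma fund_dep_replace e I J : I \in indep M -> J \in indep M ->
  e |: I \notin indep M -> e \in J ->
  exists f, [/\ f \in fund_dep M e I, f \notin J & f |: (J :\ e) \in indep M].
Proof.
move=> Ii Ji dep eJ; have eg := subsetP (indep_ground Ji) _ eJ.
have [Cc sC] := fund_circuitP Ii eg dep.
have Di := indepS Ii (fund_dep_subset Ii eg dep).
have [K [Ki sDK sKU leK]] := indep_extend Di Ji.
have eK : e \notin K.
  apply/negP=> eK; have := circuit_dep (K := K) Cc; rewrite Ki => /(_ _)/negP[] //.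
  apply/subsetP=> x xC; have [->//|xe] := eqVneq x e.
  by apply: (subsetP sDK); rewrite !inE xe.
have lt : #|J :\ e| < #|K| by apply: leq_trans leK; rewrite (cardsD1 e J) eJ.
have [f /setDP[fK fJ] fi] := indep_aug (indepS Ji (subsetDl _ _)) Ki lt.
(* As [e] is not in [K], [f] differs from [e] and thus lies outside all of [J]; being in [K], it
   comes from [fund_dep M e I]. *)
have fJ' : f \notin J.
  by apply: contra fJ => fJ; rewrite !inE fJ andbT; apply: contraNneq eK => <-.
exists f; split=> //; have := subsetP sKU _ fK.
by rewrite inE (negPf fJ') orbF.
Qed.

End MatroidExchange.

(** * Matchings and coalitions concentrated at one hospital *)

Section Market.
Variables (D H : finType) (G : market D H).

Local Notation edge := (D * H)%type.
Local Notation E := (edges G).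
Implicit Types (mu sigma I J K : {set edge}) (e f : edge) (d : D) (h : H).

Lemma ground_matE h e : (e \in ground (mat G h)) = (e \in E) && (e.2 == h).
Proof. by rewrite ground_mat inE. Qed.

Lemma indep_edges h I : I \in indep (mat G h) ->
  forall e, e \in I -> e \in E /\ e.2 = h.
Proof.
move=> Ii e eI; have := subsetP (indep_ground Ii) _ eI.
by rewrite ground_matE => /andP[-> /eqP].
Qed.

Lemma matching_indep mu h : matching G mu -> edges_at mu (inr h) \in indep (mat G h).
Proof. by case/and3P=> _ _ /forallP. Qed.

Lemma matching_sub mu : matching G mu -> mu \subset E.
Proof. by case/and3P. Qed.

Lemma doctor_edge_in mu d e : doctor_edge mu d = Some e -> e \in mu /\ e.1 = d.
Proof.
by rewrite /doctor_edge; case: pickP => // x; rewrite inE => /andP[xm /eqP xd] [<-].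
Qed.

Lemma doctor_edge_eq mu e : matching G mu -> e \in mu ->
  doctor_edge mu e.1 = Some e.
Proof.
case/and3P=> _ /forallP/(_ e.1)/card_le1P le1 _ emu.
rewrite /doctor_edge; have emu' : e \in edges_at mu (inl e.1) by rewrite !inE emu /=.
case: pickP => [x xm|/(_ e)]; last by rewrite emu'.
by have := le1 _ emu' x; rewrite xm => /esym/eqP->.
Qed.

Lemma doctor_edge_dom mu d : matching G mu ->
  doctor_edge mu d \in None |: Some @: edges_at E (inl d).
Proof.
move=> mm; case Ed: doctor_edge => [e|]; last by rewrite !inE.
have [emu ed] := doctor_edge_in Ed; rewrite !inE; apply/imset_f.
by rewrite !inE (subsetP (matching_sub mm)) //= ed.
Qed.

Lemma edges_at_doctor mu d : matching G mu ->
  edges_at mu (inl d) = [set e | doctor_edge mu d == Some e].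
Proof.
move=> mm; apply/setP=> e; rewrite !inE; apply/andP/eqP.
  by case=> emu /eqP <-; apply: doctor_edge_eq.
by move/doctor_edge_in => [-> /= ->].
Qed.

Lemma edges_at_star h K : K \in indep (mat G h) ->
  forall h', edges_at K (inr h') = if h' == h then K else set0.
Proof.
move=> Ki h'; apply/setP=> e; rewrite inE /=.
have [->|ne] := eqVneq h' h; case eK: (e \in K) => //=; rewrite ?inE //.
  by rewrite (indep_edges Ki eK).2 eqxx.
by rewrite (indep_edges Ki eK).2 eq_sym (negPf ne).
Qed.

(** All edges of [K] end at [h], so the only one a doctor [d] can have is [(d, h)]. *)
Lemma matching_star h K : K \in indep (mat G h) -> matching G K.
Proof.
move=> Ki; apply/and3P; split.
- by apply/subsetP=> e /(indep_edges Ki)[].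
- apply/forallP=> d; apply: leq_trans (_ : #|[set (d, h)]| <= 1); last by rewrite cards1.
  apply/subset_leq_card/subsetP=> -[d' h']; rewrite !inE /= => /andP[/(indep_edges Ki)[_ /= ->]].
  by move/eqP->.
- apply/forallP=> h'; rewrite (edges_at_star Ki).
  by case: eqP => [->//|_]; apply: indep0.
Qed.

(** The matching [K] itself serves as sigma, with [h] and the doctors of [K] as coalition. Doctors
    displaced from [h] and all other hospitals stay outside, so their losses do not count. *)
Lemma star_coalition_blocks mu h K : matching G mu -> K \in indep (mat G h) ->
  hpref G h K (edges_at mu (inr h)) -> K != edges_at mu (inr h) ->
  {in K, forall e, weakly_blocks_on_doctor G e mu} ->
  exists2 C : {set D + H}, C != set0 & coalition_super_weakly_blocks G C mu.
Proof.
move=> mm Ki prefK neK docK; have Km := matching_star Ki.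
pose C : {set D + H} := inr h |: [set inl e.1 | e in K].
have hC : inr h \in C by rewrite !inE eqxx.
have dC e : e \in K -> inl e.1 \in C.
  by move=> eK; apply/setUP; right; apply: (imset_f (fun e => inl e.1)).
have CE v : v \in C -> v = inr h \/ exists2 e, e \in K & v = inl e.1.
  by case/setU1P=> [->|/imsetP[e eK ->]]; [left|right; exists e].
exists C; first by apply/set0Pn; exists (inr h).
apply/existsP; exists K; apply/and3P; split.
- rewrite inE Km /=; apply/forall_inP=> v _; apply/subsetP=> e; rewrite inE => /andP[eK _].
  by have [eE eh] := indep_edges Ki eK; rewrite inE eE dC //= eh.
- apply/forall_inP=> v /CE[->|[e eK ->]] /=; first by rewrite (edges_at_star Ki) eqxx.
  by rewrite (doctor_edge_eq Km eK); apply: docK.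
- by apply/exists_inP; exists (inr h); rewrite // (edges_at_star Ki) eqxx.
Qed.

(** Totality on a repeated element is reflexivity. This covers the coalition doctors that keep their
    edge. *)
Lemma blocks_on_doctor_own mu e : matching G mu -> e \in mu ->
  weakly_blocks_on_doctor G e mu.
Proof.
move=> mm emu; have De := doctor_edge_eq mm emu.
have := doctor_edge_dom e.1 mm; rewrite /weakly_blocks_on_doctor De => dom.
by have [tot _] := dpref_order G e.1; have := tot _ _ dom dom; rewrite orbb.
Qed.

(** * Consequences of responsiveness, and the two directions between blocking edges and blocking
    coalitions *)

Section Responsive.
Hypothesis hresp : responsive G.

(** Deleting the elements of [I :\: J] one at a time makes the set strictly worse each time. The
    second conjunct expresses strictness unless the sets coincide. *)
Lemma responsive_subset h I J : I \in indep (mat G h) -> J \subset I ->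
  hpref G h I J /\ (hpref G h J I -> J = I).
Proof.
have [tot tr] := hpref_order G h.
move=> Ii; have [n] := ubnP #|I :\: J|.
elim: n I Ii => // n IHn I Ii lt sJI.
have [sIJ|] := boolP (I \subset J).
  have -> : J = I by apply/eqP; rewrite eqEsubset sJI.
  by split=> //; have := tot _ _ Ii Ii; rewrite orbb.
case/subsetPn=> x xI xJ; have Ixi := indepS Ii (subsetDl I [set x]).
have Ji := indepS Ii sJI.
have [] := IHn _ Ixi; last 1 first.
- have [/(_ _ _ Ii xI)/andP[p1 p2] _] := hresp h.
  move=> q1 _; split; first exact: tr _ _ _ Ixi Ii Ji p1 q1.
  by move=> q; case/negP: p2; apply: tr _ _ _ Ji Ixi Ii q1 q.
- apply: leq_trans (_ : #|I :\: J| <= n); last by rewrite -ltnS.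
  apply: proper_card; apply/properP; split; first by rewrite setSD ?subsetDl.
  by exists x; rewrite !inE ?xI ?xJ ?eqxx.
- by rewrite subsetD1 sJI.
Qed.

(** Induction on [#|J :\: I|]: swapping some [e] outside [I] for an [f] of its fundamental circuit
    strictly improves [J] and brings it closer to [I]. *)
Lemma unblocked_best h I J : I \in indep (mat G h) -> J \in indep (mat G h) ->
  {in J :\: I, forall e, e |: I \notin indep (mat G h) /\
     {in fund_dep (mat G h) e I, forall f, ~~ hpref G h [set e] [set f]}} ->
  hpref G h I J /\ (hpref G h J I -> J = I).
Proof.
have [tot tr] := hpref_order G h.
move=> Ii; have [n] := ubnP #|J :\: I|.
elim: n J => // n IHn J lt Ji nob.
have [sJI|] := boolP (J \subset I); first exact: responsive_subset.
case/subsetPn=> e eJ eI.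
have [|dep worse] := nob e; first by rewrite inE eI.
have [f [fD fJ Ki]] := fund_dep_replace Ii Ji dep eJ.
have eg := subsetP (indep_ground Ji) _ eJ.
have fI := subsetP (fund_dep_subset Ii eg dep) _ fD.
pose K := f |: (J :\ e); rewrite -/K in Ki.
have ne : e != f by apply: contraNneq eI => ->.
(* Responsiveness is applied at [K], with [J] seen as the result of trading [f] back for [e]. *)
have KJ : (e |: K) :\ f = J.
  apply/setP=> x; rewrite !inE; have [->|_] := eqVneq x f; first by rewrite (negPf fJ).
  by case: eqVneq => [->|].
have nJK : ~~ hpref G h J K.
  have eK : e \in edges_at E (inr h) :\: K by rewrite inE -ground_mat eg !inE (negPf ne) eqxx.
  have [_ /(_ K e f Ki eK (setU11 _ _))] := hresp h.
  by rewrite KJ => /(_ Ji) [prefI _]; apply/negP=> /prefI; apply/negP/worse.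
have pKJ : hpref G h K J by have := tot _ _ Ki Ji; rewrite (negPf nJK) orbF.
have sub : K :\: I \subset J :\: I.
  apply/subsetP=> x; rewrite !inE => /andP[xI]; rewrite xI.
  by case/orP=> [/eqP xf|/andP[_ ->//]]; rewrite xf fI in xI.
have [] := IHn K.
- apply: leq_trans (_ : #|J :\: I| <= n); last by rewrite -ltnS.
  apply: proper_card; apply/properP; split=> //; exists e; rewrite !inE eI //=.
  by rewrite eqxx (negPf ne).
- exact: Ki.
- by move=> x /(subsetP sub); apply: nob.
- move=> pIK _; split; first exact: tr _ _ _ Ki Ii Ji pIK pKJ.
  by move=> q; case/negP: nJK; apply: tr _ _ _ Ii Ji Ki q pIK.
Qed.

Lemma blocking_edge_coalition mu e : matching G mu -> e \in E :\: mu ->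
  edge_super_weakly_blocks G e mu ->
  exists2 C : {set D + H}, C != set0 & coalition_super_weakly_blocks G C mu.
Proof.
move=> mm /setDP[eE emu] /andP[bd]; rewrite /weakly_blocks_on_hospital /=.
set h := e.2; set I := edges_at mu (inr h).
have Ii : I \in indep (mat G h) by apply: matching_indep.
have eg : e \in ground (mat G h) by rewrite ground_matE eE /=.
have eI : e \notin I by rewrite inE (negPf emu).
have doc K : K \subset e |: I -> {in K, forall g, weakly_blocks_on_doctor G g mu}.
  move=> sK g /(subsetP sK)/setU1P[->//|]; rewrite inE => /andP[gmu _].
  exact: blocks_on_doctor_own.
have [ins eqv] := hresp h.
case/orP=> [Ki|/andP[dep /exists_inP[f fD pef]]].
- apply: (star_coalition_blocks mm Ki); rewrite -/I; last exact: doc.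
    by have := ins _ e Ki (setU11 _ _); rewrite setU1K // => /andP[].
  by apply: contraNneq eI => <-; rewrite setU11.
- have Ki := fund_dep_exchange Ii eg dep fD.
  have fI := subsetP (fund_dep_subset Ii eg dep) _ fD.
  apply: (star_coalition_blocks mm Ki); rewrite -/I; last exact/doc/subsetDl.
    by apply/(eqv I e f) => //; rewrite -ground_mat inE eI.
  by apply: contraTneq fI => <-; rewrite !inE eqxx.
Qed.

Lemma blocking_coalition_edge mu (C : {set D + H}) : matching G mu ->
  coalition_super_weakly_blocks G C mu ->
  exists2 e, e \in E :\: mu & edge_super_weakly_blocks G e mu.
Proof.
move=> mm /exists_inP[sigma]; rewrite inE => /andP[sm /forall_inP sC].
case/andP=> /forall_inP pref /exists_inP[v vC neqv].
(* If [v] is a doctor, the new edge is its sigma-edge, whose other end is in [C]; if [v] is a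
   hospital, a sigma-set inside its mu-set could be weakly preferred only if equal. *)
have [h hC [e0 e0s e0mu]] : exists2 h, inr h \in C &
    exists2 e, e \in edges_at sigma (inr h) & e \notin edges_at mu (inr h).
  case: v vC neqv => [d|h] vC neqv.
    have := pref _ vC; rewrite /=; case Es: (doctor_edge sigma d) => [e|].
      have [es ed] := doctor_edge_in Es => _.
      have := subsetP (sC _ vC) e; rewrite !inE es /= ed eqxx => /(_ isT).
      case/and3P=> _ _ hC; exists e.2 => //; exists e; first by rewrite inE es /=.
      apply: contra neqv; rewrite inE => /andP[emu _].
      by rewrite !edges_at_doctor // Es -ed (doctor_edge_eq mm emu).
    (* A doctor unmatched in sigma but matched in mu would strictly prefer mu. *)
    case Em: (doctor_edge mu d) => [g|] p.
      have [gmu gd] := doctor_edge_in Em.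
      have gE : g \in edges_at E (inl d) by rewrite inE (subsetP (matching_sub mm)) //= gd.
      by have /andP[_] := dpref_None gE; rewrite p.
    by case/negP: neqv; rewrite !edges_at_doctor // Es Em.
  exists h => //; have [sub|/subsetPn[e es emu]] :=
    boolP (edges_at sigma (inr h) \subset edges_at mu (inr h)); last by exists e.
  have [_ eqsub] := responsive_subset (matching_indep h mm) sub.
  by case/eqP: neqv; apply/eqsub/(pref _ vC).
have Ii := matching_indep h mm; have Ji := matching_indep h sm.
(* The blocking edge may differ from [e0], which only witnesses that the two sets at [h] are
   distinct. *)
have /exists_inP[e /setDP[es emu] bh] :
    [exists e in edges_at sigma (inr h) :\: edges_at mu (inr h),
       weakly_blocks_on_hospital G e mu].
  apply: contraT => /exists_inPn nob.
  have [|_ /(_ (pref _ hC)) eqJI] := unblocked_best Ii Ji; first move=> e eJI.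
    have eh : e.2 = h by move: eJI; rewrite !inE => /andP[_ /andP[_ /eqP]].
    have := nob e eJI; rewrite /weakly_blocks_on_hospital eh negb_or => /andP[dep].
    by rewrite dep /= => /exists_inPn.
  by case/negP: e0mu; rewrite -eqJI.
move: es; rewrite inE => /andP[es /= /eqP eh].
have emu' : e \notin mu by move: emu; rewrite inE /= eh eqxx andbT.
exists e; first by rewrite inE emu' (subsetP (matching_sub sm)).
rewrite /edge_super_weakly_blocks bh andbT /weakly_blocks_on_doctor.
(* Sigma-edges at [h] stay within the coalition, so the doctor of [e] is a member and weakly prefers
   [e] to its mu-assignment. *)
have := subsetP (sC _ hC) e; rewrite !inE es /= eh eqxx => /(_ isT)/and3P[_ dC _].
by have := pref _ dC; rewrite /= (doctor_edge_eq sm es).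
Qed.

End Responsive.
End Market.

Theorem theorem3 (D H : finType) (G : market D H) (hresp : responsive G) :
  super_stable_matchings G = super_core G.
Proof.
apply/setP=> mu; rewrite !inE; case mm: (matching G mu) => //=.
apply/forall_inP/forallP=> [stable C|core e eE].
- apply/implyP=> _; apply/negP=> /(blocking_coalition_edge hresp mm)[e eE].
  exact/negP/stable.
- apply/negP=> /(blocking_edge_coalition hresp mm eE)[C C0].
  by apply/negP; have := core C; rewrite C0.
Qed.
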